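(* Let $p\in(0,1]$ and let $M_1,M_2$ be functions on $[0,1]$ such that $t\mapsto M_1(t^{1/p})$ and $t\mapsto M_2(t^{1/p})$ are Orlicz functions, with fundamental functions $\varphi_{M_1},\varphi_{M_2}$. Assume that $\varphi_{M_1}/\varphi_{M_2}$ is non-decreasing on $[1,\infty)$. Let $k\in\mathbb{N}$ and let $(\alpha_i)_{i=1}^\infty$ be a non-increasing sequence of non-negative real numbers with $\alpha_1=\alpha_k$. Set $$\Theta(k):=\max_{k\le n\le 2^{k-1}}\ \alpha_n\,\frac{\varphi_{M_2}\left(k/\log(2n/k)\right)}{\varphi_{M_1}\left(k/\log(2n/k)\right)},$$ the maximum being over integers $n$. Let $T_\alpha:\ell_{M_1}\to\ell_{M_2}$, $T_\alpha((x_i)_{i=1}^\infty)=(\alpha_i x_i)_{i=1}^\infty$, be the diagonal operator generated by $(\alpha_i)$. Then $$c_1(p)\,\Theta(k)\le e_k(T_\alpha:\ell_{M_1}\to\ell_{M_2})\le c_2(p)\,\Theta(k),$$ where $$c_1(p)=4^{-2}\,2^{-19/p}\left(\log\tfrac{24}{p}\right)^{-2/p}\left(\tfrac1p\right)^{-1/p},\qquad c_2(p)=4\cdot 2^{19/p}\left(\log\tfrac{24}{p}\right)^{2/p}\left(\tfrac1p\right)^{1/p}.$$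
   Context: All spaces are real; $\log=\log_2$; $\mathbb{N}=\{1,2,\dots\}$. Orlicz function: a continuous, strictly increasing, convex function $N:[0,1]\to\mathbb{R}$ with $N(0)=0$, $N(1)=1$. Orlicz sequence space: for $M$ on $[0,1]$ such that $t\mapsto M(t^{1/p})$ is an Orlicz function for some $p\in(0,1]$, $\ell_M=\{x=(x_i)_{i=1}^\infty:\ \sum_i M(|x_i|/\varrho)<\infty\text{ for some }\varrho>0\}$ with the $p$-norm $\|x\|_{\ell_M}=\inf\{\varrho>0:\ \sum_{i} M(|x_i|/\varrho)\le 1\}$. Convention: $M(t)=+\infty$ for $t>1$, so only $\varrho$ with $|x_i|\le\varrho$ for all $i$ are admissible. Fundamental function: $\varphi_M(t)=1/M^{-1}(1/t)$ for $t\ge1$. Entropy numbers: for a continuous linear map $T:X\to Y$ between quasi-Banach spaces with closed unit balls $B_X,B_Y$, $e_k(T)=\inf\{\varepsilon>0:\ T(B_X)\subset\bigcup_{i=1}^{2^{k-1}}(y_i+\varepsilon B_Y)\text{ for some }y_1,\dots,y_{2^{k-1}}\in Y\}$. *)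

(* Defs.v *)
(* Real sequences (x_1, x_2, ...) are functions nat -> R indexed from 0: the
   term x_i is [x i.-1]. Functions on [0, 1] are total functions R -> R of
   which only the restriction to [0, 1] is used. *)
From HB Require Import structures.
From mathcomp Require Export all_boot all_order all_algebra.
From mathcomp Require Export all_classical all_reals all_analysis.

Set Implicit Arguments.
Unset Strict Implicit.
Unset Printing Implicit Defensive.

Import Order.TTheory GRing.Theory Num.Theory.
Import numFieldNormedType.Exports.

Local Open Scope classical_set_scope.
Local Open Scope ring_scope.

Definition log2 (R : realType) (x : R) : R := ln x / ln 2.

Definition Orlicz_function (R : realType) (N : R -> R) : Prop :=
  [/\ {within `[0, 1], continuous N},
      {in `[0, 1] &, {homo N : s t / s < t}},
      convex_function (`[0, 1] : set R) N,
      N 0 = 0 & N 1 = 1].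

Definition p_Orlicz_function (R : realType) (p : R) (M : R -> R) : Prop :=
  Orlicz_function (fun t => M (t `^ p^-1)).

Definition modular_term (R : realType) (M : R -> R) (t : R) : \bar R :=
  if t <= 1 then (M t)%:E else +oo%E.

Definition Orlicz_modular (R : realType) (M : R -> R) (x : nat -> R) (rho : R)
    : \bar R :=
  (\sum_(0 <= i <oo) modular_term M (`|x i| / rho))%E.

Definition Orlicz_space (R : realType) (M : R -> R) : set (nat -> R) :=
  [set x | exists2 rho : R, 0 < rho & (Orlicz_modular M x rho < +oo)%E].

Definition Orlicz_norm (R : realType) (M : R -> R) (x : nat -> R) : R :=
  inf [set rho : R | 0 < rho /\ (Orlicz_modular M x rho <= 1)%E].

(* [Orlicz_norm] is meaningful on [Orlicz_space M] only: elsewhere it is the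
   default value 0 of [inf set0]. *)
Definition Orlicz_ball (R : realType) (M : R -> R) : set (nat -> R) :=
  [set x | Orlicz_space M x /\ Orlicz_norm M x <= 1].

(* The inverse is that of M restricted to [0, 1]. *)
Definition fundamental_function (R : realType) (M : R -> R) (t : R) : R :=
  1 / 'pinv_(fun=> 0) `[0, 1] M (1 / t).

(* Entropy numbers of T : X -> Y, where BX is the closed unit ball of X, Y is a
   subspace of W and BY is the closed unit ball of Y. The infimum is taken in
   \bar R, so that it is +oo when no finite covering exists. *)
Definition entropy_number (R : realType) (V W : lmodType R)
    (BX : set V) (Y BY : set W) (T : V -> W) (k : nat) : \bar R :=
  ereal_inf [set e%:E | e in [set e : R | 0 < e /\
    exists y : 'I_(2 ^ k.-1) -> W, (forall i, Y (y i)) /\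
      T @` BX `<=` \bigcup_i [set y i + e *: z | z in BY]]].

Definition diagonal_operator (R : realType) (alpha x : nat -> R) : nat -> R :=
  fun i => alpha i * x i.

Definition diagonal_entropy (R : realType) (M1 M2 : R -> R) (alpha : nat -> R)
    (k : nat) : \bar R :=
  @entropy_number R (nat -> R^o) (nat -> R^o)
    (Orlicz_ball M1) (Orlicz_space M2) (Orlicz_ball M2)
    (diagonal_operator alpha) k.

(* All the terms are non-negative and the range is non-empty for k >= 1, so the
   initial value 0 of the iterated maximum is harmless. *)
Definition Theta (R : realType) (M1 M2 : R -> R) (alpha : nat -> R) (k : nat)
    : R :=
  \big[Num.max/0]_(k <= n < (2 ^ k.-1).+1)
    (let t := k%:R / log2 (2 * n%:R / k%:R) in
     alpha n.-1 * (fundamental_function M2 t / fundamental_function M1 t)).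

Definition c1 (R : realType) (p : R) : R :=
  4 ^- 2 * 2 `^ (- (19 / p)) * log2 (24 / p) `^ (- (2 / p))
    * (1 / p) `^ (- (1 / p)).

Definition c2 (R : realType) (p : R) : R :=
  4 * 2 `^ (19 / p) * log2 (24 / p) `^ (2 / p) * (1 / p) `^ (1 / p).

(* Main.v *)
(* Write J_M for the inverse of M on [0, 1] and n_i := max(i, k),
   s_i := log2(2 n_i / k) / k. The monotonicity of the ratio of the fundamental
   functions says that J_{M2} / J_{M1} is non-increasing, and Theta is the least
   A with alpha_i J_{M1}(s_i) <= A J_{M2}(s_i) for all i <= 2^(k-1).

   Upper bound: round the coordinate alpha_i x_i, i <= 2^(k-1), to g_i times
   A (64/p)^(1/p) J_{M2}(s_i) and replace the other coordinates by 0. The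
   monotonicity makes the error at i cost at most M1 |x_i|, while a non-zero g_i
   forces |g_i|^p (64/p) s_i <= M1 |x_i|. Hence sum_i |g_i|^p log2(2 n_i / k)
   <= k p / 64, and an exponential-moment count shows that at most 2^(k-1)
   integer vectors satisfy this.

   Lower bound: for k <= n <= 2^(k-1) let t := k / log2(2n/k) and cut {1, .., n}
   into m ~ t blocks. Choosing in each block a position and one of 16 heights
   gives points of the ball; as there are more than 2^(k-1) Hamming balls' worth
   of them, two of them lie in the same e-ball but differ in more than m/2
   blocks; the modular of their difference then bounds e from below. *)
Require Import Defs.
From mathcomp Require Import ring lra zify.
Set Implicit Arguments.
Unset Strict Implicit.
Unset Printing Implicit Defensive.
Import Order.TTheory GRing.Theory Num.Theory.
Import numFieldNormedType.Exports.
Local Open Scope classical_set_scope.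
Local Open Scope ring_scope.

(** * Orlicz functions and balls *)

(** This is J_M. At t = 1 / s the fundamental function is 1 / J_M(s), which turns estimates in t >=
    1 into estimates in s in (0, 1]. *)
Definition Orlicz_inverse (R : realType) (M : R -> R) (s : R) : R :=
  'pinv_(fun=> 0) `[0, 1] M s.

Lemma powR_le1 (R : realType) (c q : R) : 0 <= q -> 0 <= c -> c <= 1 ->
  c `^ q <= 1.
Proof.
move=> q0 c0 c1; have := ge0_ler_powR q0 _ _ c1.
by rewrite powR1; apply; rewrite nnegrE.
Qed.

Section OrliczFunction.
Context {R : realType} {p : R} {M : R -> R}.
Hypotheses (p_gt0 : 0 < p) (M_Orlicz : p_Orlicz_function p M).

Let pV_neq0 : p^-1 != 0.
Proof. by rewrite invr_neq0// gt_eqF. Qed.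

Let powRpV t : 0 <= t -> (t `^ p) `^ p^-1 = t.
Proof. by move=> t0; rewrite -powRrM mulfV ?gt_eqF// powRr1. Qed.

Let powR01 t : 0 <= t <= 1 -> 0 <= t `^ p <= 1.
Proof.
by move=> /andP[t0 t1]; rewrite powR_ge0 powR_le1// ltW.
Qed.

Lemma Orlicz0 : M 0 = 0.
Proof. by case: M_Orlicz => _ _ _; rewrite powR0. Qed.

Lemma Orlicz1 : M 1 = 1.
Proof. by case: M_Orlicz => _ _ _ _; rewrite powR1. Qed.

Lemma Orlicz_lt (s t : R) : 0 <= s -> s < t -> t <= 1 -> M s < M t.
Proof.
move=> s0 st t1; have t0 : 0 <= t by exact: le_trans (ltW st).
have s1 : s <= 1 by exact: le_trans (ltW st) _.
case: M_Orlicz => _ /(_ (s `^ p) (t `^ p)) + _ _ _.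
rewrite !powRpV//; apply; rewrite ?in_itv/= ?powR01 ?s0 ?t0//.
by apply: gt0_ltr_powR; rewrite ?nnegrE.
Qed.

Lemma Orlicz_le (s t : R) : 0 <= s -> s <= t -> t <= 1 -> M s <= M t.
Proof.
move=> s0; rewrite le_eqVlt => /orP[/eqP->//|st] t1.
exact/ltW/Orlicz_lt.
Qed.

Lemma Orlicz_ge0 (t : R) : 0 <= t -> t <= 1 -> 0 <= M t.
Proof. by move=> t0 t1; rewrite -Orlicz0; exact: Orlicz_le. Qed.

Lemma Orlicz_le1 (t : R) : 0 <= t -> t <= 1 -> M t <= 1.
Proof. by move=> t0 t1; rewrite -[leRHS]Orlicz1; exact: Orlicz_le. Qed.

(** Convexity of t |-> M (t^(1/p)) on the segment from 0 to t^p; it takes the place of convexity of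
    M, which may fail for p < 1. *)
Lemma Orlicz_scale (c t : R) : 0 <= c -> c <= 1 -> 0 <= t -> t <= 1 ->
  M (c `^ p^-1 * t) <= c * M t.
Proof.
move=> c0 c1 t0 t1; case: M_Orlicz => _ _ + N0 _.
move=> /(_ (Itv01 c0 c1) (t `^ p) 0).
rewrite !inE /= !in_itv/= lexx ler01 powR01 ?t0// => /(_ isT isT).
rewrite convRE/= N0 mulr0 addr0 powRpV// => H.
rewrite -[t in leLHS]powRpV// -powRM ?powR_ge0//.
by rewrite -[X in M (X `^ _)]addr0 -(mulr0 (unstable.onem c)); exact: H.
Qed.

(** The intermediate value theorem for t |-> M (t^(1/p)) gives a preimage, and strict monotonicity
    makes it the one that ['pinv_] returns. *)
Lemma Orlicz_inverse_itv (s : R) : 0 <= s -> s <= 1 ->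
  [/\ 0 <= Orlicz_inverse M s, Orlicz_inverse M s <= 1 &
      M (Orlicz_inverse M s) = s].
Proof.
move=> s0 s1.
have [c /andP[c0 c1] <-] : exists2 c, 0 <= c <= 1 & M c = s.
  case: M_Orlicz => cN _ _ N0 N1; have [|c] := @IVT R _ 0 1 s ler01 cN.
    by rewrite N0 N1 min_l ?max_r ?ler01// s0.
  rewrite in_itv/= => /andP[c0 c1] <-; exists (c `^ p^-1) => //.
  by rewrite powR_ge0 powR_le1// invr_ge0 ltW.
have -> : Orlicz_inverse M (M c) = c; last by [].
apply: pinvKV; last by rewrite inE/= in_itv/= c0.
move=> x y; rewrite !inE/= !in_itv/= => /andP[x0 x1] /andP[y0 y1] xy.
by case: (ltgtP x y) => // /Orlicz_lt => [/(_ x0 y1)|/(_ y0 x1)];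
  rewrite xy ltxx.
Qed.

Lemma Orlicz_le_inverse (s t : R) : 0 <= s -> s <= 1 -> 0 <= t -> t <= 1 ->
  (M t <= s) = (t <= Orlicz_inverse M s).
Proof.
move=> s0 s1 t0 t1; have [i0 i1 Mi] := Orlicz_inverse_itv s0 s1.
apply/idP/idP => [|h]; last by rewrite -Mi; exact: Orlicz_le.
rewrite leNgt; apply: contraTT; rewrite negbK -ltNge => h.
by rewrite -Mi; exact: Orlicz_lt.
Qed.

Lemma Orlicz_inverse_le (s t : R) : 0 <= s -> s <= t -> t <= 1 ->
  Orlicz_inverse M s <= Orlicz_inverse M t.
Proof.
move=> s0 st t1; have [//||i0 i1 Mi] := @Orlicz_inverse_itv s.
  exact: le_trans t1.
by rewrite -Orlicz_le_inverse ?Mi// (le_trans s0).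
Qed.

Lemma Orlicz_inverse_gt0 (s : R) : 0 < s -> s <= 1 -> 0 < Orlicz_inverse M s.
Proof.
move=> s0 s1; have [i0 i1 Mi] := Orlicz_inverse_itv (ltW s0) s1.
rewrite lt0r i0 andbT; apply: contraTneq s0 => e.
by rewrite -Mi e Orlicz0 ltxx.
Qed.

Lemma Orlicz_inverse_scale (c s : R) : 0 <= c -> c <= 1 -> 0 <= s -> s <= 1 ->
  c `^ p^-1 * Orlicz_inverse M s <= Orlicz_inverse M (c * s).
Proof.
move=> c0 c1 s0 s1; have [i0 i1 Mi] := Orlicz_inverse_itv s0 s1.
have cp : c `^ p^-1 <= 1 by rewrite powR_le1// invr_ge0 ltW.
rewrite -Orlicz_le_inverse ?mulr_ge0 ?mulr_ile1 ?powR_ge0//.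
by rewrite (le_trans (Orlicz_scale _ _ _ _))// Mi.
Qed.

(** The value +oo beyond 1 becomes a pointwise bound on x, and the series becomes real partial sums,
    so that later proofs handle finite sums only. *)
Lemma Orlicz_modular_le (x : nat -> R) (rho B : R) : 0 < rho ->
  (Orlicz_modular M x rho <= B%:E)%E <->
  (forall i, `|x i| <= rho) /\
  forall n, \sum_(i < n) M (`|x i| / rho) <= B.
Proof.
move=> rho0.
have term_ge0 i : (0 <= modular_term M (`|x i| / rho))%E.
  rewrite /modular_term; case: ifPn => // h.
  by rewrite lee_fin Orlicz_ge0// divr_ge0// ltW.
have termE (n : nat) : (forall i, `|x i| <= rho) ->
    (\sum_(0 <= i < n) modular_term M (`|x i| / rho) =
     (\sum_(i < n) M (`|x i| / rho))%:E)%E.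
  move=> xrho; rewrite big_mkord -sumEFin; apply: eq_bigr => i _.
  by rewrite /modular_term ler_pdivrMr// mul1r xrho.
split=> [h|[xrho h]].
  have xrho i : `|x i| <= rho.
    have := le_trans (nneseries_lim_ge i.+1 (fun n _ _ => term_ge0 n)) h.
    rewrite big_nat_recr//= {2}/modular_term ler_pdivrMr// mul1r.
    case: ifP => // _; rewrite addey ?leye_eq//.
    by rewrite gt_eqF// (lt_le_trans (ltNyr 0))// sume_ge0.
  split=> // n; rewrite -lee_fin -termE//.
  exact: le_trans (nneseries_lim_ge n (fun n _ _ => term_ge0 n)) h.
apply: lime_le; first by apply: is_cvg_nneseries => i _ _.
by apply: nearW => n; rewrite termE// lee_fin.
Qed.

(* Rescaling by 2 avoids proving that the infimum in the norm is attained. *)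
Lemma Orlicz_ball_modular_le1 (x : nat -> R) : Orlicz_ball M x ->
  (forall i, `|x i / 2| <= 1) /\
  forall n, \sum_(i < n) M `|x i / 2| <= 1.
Proof.
move=> [[rho rho0 fin] norm1].
(* The set defining the norm is non-empty: a finite modular at most B, with B >= 1, drops to at most
   1 once rho is enlarged by the factor B^(1/p). This excludes the default value 0 of [inf set0]. *)
have [rho' rho'0 mod1] : exists2 rho', 0 < rho' &
    (Orlicz_modular M x rho' <= 1)%E.
  have [B [B1 modB]] : exists B, 1 <= B /\ (Orlicz_modular M x rho <= B%:E)%E.
    case: (Orlicz_modular M x rho) fin => [r _| |_]//; last first.
      by exists 1; rewrite lexx leNye.
    by exists (Num.max 1 r); rewrite lee_fin !le_max !lexx orbT.
  have [xrho sumB] := (Orlicz_modular_le x B rho0).1 modB.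
  have B0 : 0 < B by exact: lt_le_trans B1.
  have c0 : 0 < B^-1 `^ p^-1 by rewrite powR_gt0// invr_gt0.
  exists (rho / B^-1 `^ p^-1); first by rewrite divr_gt0.
  have c1 : B^-1 `^ p^-1 <= 1 by rewrite powR_le1 ?invr_ge0 ?invf_le1// ltW.
  apply/Orlicz_modular_le; first by rewrite divr_gt0.
  split=> [i|n].
    by rewrite (le_trans (xrho i))// ler_peMr ?(ltW rho0)// invf_ge1.
  have -> : 1 = B^-1 * B :> R by rewrite mulVf// gt_eqF.
  apply: le_trans (ler_wpM2l _ (sumB n)); last by rewrite invr_ge0 ltW.
  rewrite mulr_sumr ler_sum// => i _.
  rewrite invf_div mulrCA Orlicz_scale ?invr_ge0 ?(ltW B0) ?invf_le1//.
    by rewrite divr_ge0// ltW.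
  by rewrite ler_pdivrMr// mul1r.
have [] := @inf_lt R [set rho : R | 0 < rho /\ (Orlicz_modular M x rho <= 1)%E]
  2.
- by exists rho'.
- by apply: le_lt_trans norm1 _; rewrite ltr1n.
move=> r [r0 /(Orlicz_modular_le _ _ r0)[xr sum1]] r2.
have le2 i : `|x i / 2| <= `|x i| / r.
  by rewrite normrM ler_wpM2l// ger0_norm ?invr_ge0// lef_pV2 ?ltW// posrE.
have r1 i : `|x i| / r <= 1 by rewrite ler_pdivrMr// mul1r.
split=> [i|n]; first exact: le_trans (le2 i) _.
by rewrite (le_trans _ (sum1 n))// ler_sum// => i _; rewrite Orlicz_le.
Qed.

Lemma Orlicz_ballP (x : nat -> R) : (forall i, `|x i| <= 1) ->
  (forall n, \sum_(i < n) M `|x i| <= 1) -> Orlicz_ball M x.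
Proof.
move=> x1 sum1; have mod1 : (Orlicz_modular M x 1 <= 1)%E.
  apply/Orlicz_modular_le => //; split=> // n.
  by under eq_bigr do rewrite divr1.
split; first by exists 1 => //; rewrite (le_lt_trans mod1)// ltry.
apply: ge_inf; last by split.
by exists 0 => r /= [/ltW].
Qed.

End OrliczFunction.

(** * Counting *)

(* Chernoff's bound: e^(B - sum f) >= 1 on the counted functions. *)
Lemma card_sum_le (R : realType) (I A : finType) (f : I -> A -> R) (B : R) :
  #|[pred c : {ffun I -> A} | \sum_i f i (c i) <= B]|%:R <=
    expR B * \prod_i \sum_a expR (- f i a).
Proof.
rewrite bigA_distr_bigA mulr_sumr /= -sum1_card natr_sum.
rewrite [leRHS](bigID (fun c : {ffun I -> A} => \sum_i f i (c i) <= B))/=.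
rewrite -[leLHS]addr0 lerD// ?sumr_ge0// => [|c _]; last first.
  by rewrite mulr_ge0 ?expR_ge0// prodr_ge0// => i _; exact: expR_ge0.
apply: ler_sum => c; rewrite inE => cB.
by rewrite -expR_sum -expRD sumrN -[1%:R]expR0 ler_expR subr_ge0.
Qed.

Lemma sum_invn2_le2 (R : realType) (n : nat) :
  \sum_(j < n) (j.+1%:R ^+ 2)^-1 <= 2 :> R.
Proof.
(* Subtracting 1/n makes the induction telescope, as 1/(n+1)^2 <= 1/n - 1/(n+1). At n = 0 the
   inverse is 0 by convention, so n = 1 is treated apart. *)
suff : \sum_(j < n) (j.+1%:R ^+ 2)^-1 <= 2 - n%:R^-1 :> R.
  by move/le_trans; apply; rewrite gerBl invr_ge0 ler0n.
elim: n => [|[|n] IHn]; first by rewrite big_ord0 invr0 subr0.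
  by rewrite big_ord1 expr1n invr1; lra.
rewrite big_ord_recr/= (le_trans (lerD IHn (lexx _)))//.
have n0 : 0 <= n%:R :> R by rewrite ler0n.
rewrite -[n.+2%:R]natr1 -[n.+1%:R]natr1; set x := n%:R in n0 *.
suff -> : 2 - (x + 1 + 1)^-1 = 2 - (x + 1)^-1 + ((x + 1) * (x + 1 + 1))^-1.
  rewrite lerD2l lef_pV2 ?posrE; first nra.
    by rewrite exprn_gt0//; lra.
  by rewrite mulr_gt0//; lra.
by field; rewrite !gt_eqF//; lra.
Qed.

Lemma sum_inv_maxn2_le (R : realType) (k n : nat) : (0 < k)%N ->
  \sum_(i < n) (k%:R / (maxn i.+1 k)%:R) ^+ 2 <= 2 * k%:R :> R.
Proof.
move=> k_gt0; have kR : 0 < k%:R :> R by rewrite ltr0n.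
have term_ge0 i : 0 <= (k%:R / (maxn i.+1 k)%:R) ^+ 2 :> R.
  by rewrite exprn_ge0// divr_ge0.
(* The first k terms equal 1; the later ones telescope, k^2/(k+j+1)^2 being at most k^2/(k+j) -
   k^2/(k+j+1). *)
suff H j : \sum_(i < k + j) (k%:R / (maxn i.+1 k)%:R) ^+ 2 <=
    2 * k%:R - k%:R ^+ 2 / (k + j)%:R :> R.
  apply: (@le_trans _ _ (\sum_(i < k + n) (k%:R / (maxn i.+1 k)%:R) ^+ 2)).
    by rewrite addnC big_split_ord/= lerDl sumr_ge0.
  by rewrite (le_trans (H n))// gerBl divr_ge0// exprn_ge0// ltW.
elim: j => [|j IHj].
  rewrite addn0 expr2 mulfK ?gt_eqF// (_ : 2 * _ - _ = k%:R); last by ring.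
  rewrite (eq_bigr (fun=> 1)) ?sumr_const ?card_ord// => i _.
  by rewrite (maxn_idPr (ltn_ord i)) divff ?gt_eqF// expr1n.
rewrite addnS big_ord_recr/= (le_trans (lerD IHj (lexx _)))//.
rewrite (maxn_idPl _); last by rewrite leqW// leq_addr.
rewrite -[(k + j).+1%:R]natr1.
have x0 : 0 < (k + j)%:R :> R by rewrite ltr0n addn_gt0 k_gt0.
set x := (k + j)%:R in x0 *; set y := k%:R in kR *.
have -> : 2 * y - y ^+ 2 / (x + 1) =
    2 * y - y ^+ 2 / x + y ^+ 2 * (x * (x + 1))^-1.
  by field; rewrite !gt_eqF//; lra.
rewrite lerD2l expr_div_n ler_wpM2l ?exprn_ge0 ?(ltW kR)// lef_pV2 ?posrE.
- nra.
- by rewrite exprn_gt0//; lra.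
- by rewrite mulr_gt0//; lra.
Qed.

Lemma ln2_gt0 (R : realType) : 0 < ln 2 :> R.
Proof. by rewrite ln_gt0// ltr1n. Qed.

Lemma ln2_le1 (R : realType) : ln 2 <= 1 :> R.
Proof. by have := @le_ln1Dx R 1; rewrite -natr1/=; apply; lra. Qed.

Lemma log2_ge1 (R : realType) (x : R) : 2 <= x -> 1 <= log2 x.
Proof.
move=> x2; rewrite /log2 ler_pdivlMr ?ln2_gt0// mul1r ler_ln// posrE//.
exact: lt_le_trans x2.
Qed.

(* The index i is 0-based, so [level R k i] is log2(2 n / k) with
   n = max(i + 1, k). *)
Definition level (R : realType) (k i : nat) : R :=
  log2 (2 * (maxn i.+1 k)%:R / k%:R).

Lemma level_ge1 (R : realType) (k i : nat) : (0 < k)%N -> 1 <= level R k i.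
Proof.
move=> k0; apply: log2_ge1; rewrite -mulrA ler_peMr//.
by rewrite ler_pdivlMr ?ltr0n// mul1r ler_nat leq_maxr.
Qed.

(** With x = 2 max(i+1, k) / k >= 2, the level is at least ln x since ln 2 <= 1, and x^(-6) <=
    x^(-2) / 16, which is the right-hand side. *)
Lemma expR_level_le (R : realType) (k i : nat) : (0 < k)%N ->
  expR (- (6 * level R k i)) <= (k%:R / (maxn i.+1 k)%:R) ^+ 2 / 64.
Proof.
move=> k_gt0; have k0 : 0 < k%:R :> R by rewrite ltr0n.
set m := (maxn i.+1 k)%:R; have km : k%:R <= m :> R by rewrite ler_nat leq_maxr.
have m0 : 0 < m by exact: lt_le_trans km.
set x : R := 2 * m / k%:R.
have x2 : 2 <= x by rewrite /x ler_pdivlMr//; nra.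
have x0 : 0 < x by exact: lt_le_trans x2.
have lnx0 : 0 <= ln x by rewrite ln_ge0//; lra.
have /le_trans : expR (- (6 * level R k i)) <= expR (- (6%:R * ln x)).
  rewrite ler_expR lerN2 ler_pM2l// -/x /level -/m -/x /log2.
  by rewrite ler_peMr// invf_ge1 ?ln2_gt0// ln2_le1.
apply; rewrite expRN expRM_natl lnK ?posrE//.
have -> : k%:R / m = 2 / x by rewrite /x; field; rewrite !gt_eqF.
rewrite (_ : (2 / x) ^+ 2 / 64 = (16 * x ^+ 2)^-1); last by field;
  rewrite gt_eqF.
rewrite lef_pV2 ?posrE ?exprn_gt0 ?(mulr_gt0 (x := 16)) ?exprn_gt0//.
rewrite (_ : 6 = 4 + 2)%N// exprD ler_pM2r; last exact: exprn_gt0.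
by rewrite (_ : 16 = 2 ^+ 4); [rewrite lerXn2r ?nnegrE// ltW|ring].
Qed.

(* [None] encodes 0 and [Some (j, b)] the integer (-1)^b (j + 1). *)
Definition code_abs (R : realType) (n : nat) (a : option ('I_n * bool)) : R :=
  if a is Some (j, _) then j.+1%:R else 0.

(** [None] contributes 1. Since g^p >= 1 + p ln g, the integers g and -g together contribute at most
    2 e^(-6 l) / g^2, and the inverse squares sum to at most 2. *)
Lemma sum_code_le (R : realType) (n : nat) (p l : R) : 0 < p -> p <= 1 ->
  1 <= l -> \sum_a expR (- (6 / p * (code_abs R (n := n) a `^ p * l))) <=
    expR (4 * expR (- (6 * l))).
Proof.
move=> p0 p1 l1; apply: le_trans (expR_ge1Dx _).
rewrite (bigD1 None)//= powR0 ?gt_eqF// mul0r mulr0 oppr0 expR0 lerD2l.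
pose F (j : nat) := expR (- (6 / p * (j.+1%:R `^ p * l))).
have -> : \sum_(a | a != None) expR (- (6 / p * (code_abs R (n := n) a `^ p *
  l)))
    = \sum_(ab : 'I_n * bool) F ab.1.
  rewrite (reindex_omap Some id)/=; last by case.
  by apply: eq_big => [ab|[]//]; rewrite eqxx.
rewrite -(pair_bigA _ (fun (j : 'I_n) (_ : bool) => F j))/=.
under eq_bigr do rewrite big_bool.
apply: (@le_trans _ _ (\sum_(j < n) 2 * expR (- (6 * l)) * (j.+1%:R ^+ 2)^-1)).
  apply: ler_sum => j _; rewrite /= (_ : F j + F j = 2 * F j); last by ring.
  rewrite -mulrA ler_pM2l// /F.
  have x1 : 1 <= j.+1%:R :> R by rewrite ler1n.
  have x0 : 0 < j.+1%:R :> R by rewrite ltr0n.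
  have lnx0 : 0 <= ln j.+1%:R :> R by rewrite ln_ge0.
  rewrite -[X in _ * (X ^+ _)^-1]lnK ?posrE// -expRM_natl -expRN -expRD
    ler_expR.
  have : 1 + p * ln j.+1%:R <= j.+1%:R `^ p.
    by rewrite /powR gt_eqF// expR_ge1Dx.
  set y := ln _ in lnx0 *; move=> h.
  rewrite -opprD lerN2 mulrAC ler_pdivlMr//.
  have py0 : 0 <= p * y by rewrite mulr_ge0// ltW.
  have : l * (1 + p * y) <= l * j.+1%:R `^ p by rewrite ler_pM2l//; lra.
  have : l * p <= l * 1 by rewrite ler_pM2l//; lra.
  have : 1 * (p * y) <= l * (p * y) by rewrite ler_wpM2r.
  by set z := _ `^ _; lra.
rewrite -mulr_sumr; have := sum_invn2_le2 R n; have := expR_ge0 (- (6 * l)).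
nra.
Qed.

(** Chernoff's bound with parameter 6/p: the budget adds 6k/64 to the exponent and the coordinates
    add 4 * 2k/64, in total 7k/32. Moreover e^(7/32) <= 32/25, because e^(-7/32) >= 1 - 7/32. *)
Lemma card_codes (R : realType) (k n m : nat) (p : R) : 0 < p -> p <= 1 ->
  (0 < k)%N ->
  (#|[pred c : {ffun 'I_n -> option ('I_m * bool)} |
      (\sum_i code_abs R (c i) `^ p * level R k i <= k%:R * p / 64)%R]| <=
   2 ^ k.-1)%N.
Proof.
move=> p0 p1 k_gt0; set S := [pred c | _].
(* Integrality matters for k = 1, where the bound 32/25 lies above 2^(k-1) = 1 but below 2. *)
suff : #|S|%:R < (2 ^ k.-1).+1%:R :> R by rewrite ltr_nat.
have : #|S|%:R <= (32 / 25) ^+ k :> R.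
  pose f (i : 'I_n) a : R := 6 / p * (code_abs R (n := m) a `^ p * level R k i).
  have -> : #|S| = #|[pred c : {ffun 'I_n
    -> _} | \sum_i f i (c i) <= 6 / 64 * k%:R]|.
    apply: eq_card => c; rewrite !inE -mulr_sumr.
    rewrite -[LHS](ler_pM2l (x := 6 / p)) ?divr_gt0//.
    by congr (_ <= _); field; rewrite gt_eqF.
  apply: (le_trans (card_sum_le _ _)).
  apply: (@le_trans _ _ (expR (6 / 64 * k%:R) *
      \prod_(i < n) expR (4 * expR (- (6 * level R k i))))).
    rewrite ler_pM2l ?expR_gt0//; apply: ler_prod => i _.
    rewrite sumr_ge0/=; last by move=> a _; exact: expR_ge0.
    by rewrite sum_code_le// level_ge1.
  rewrite -expR_sum -expRD -mulr_sumr.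
  apply: (@le_trans _ _ (expR (7 / 32 * k%:R))).
    rewrite ler_expR.
    have : \sum_(i < n) expR (- (6 * level R k i)) <= 2 * k%:R / 64 :> R.
      apply: (@le_trans _ _ (\sum_(i < n) (k%:R / (maxn i.+1 k)%:R) ^+ 2 / 64)).
        by apply: ler_sum => i _; exact: expR_level_le.
      by rewrite -mulr_suml ler_pM2r ?sum_inv_maxn2_le// invr_gt0.
    lra.
  rewrite expRM_natr lerXn2r ?nnegrE ?expR_ge0//.
  rewrite -[7 / 32]opprK expRN -[32 / 25]invrK lef_pV2 ?posrE ?expR_gt0//.
  by apply: le_trans (expR_ge1Dx _); lra.
move/le_lt_trans; apply; case: k k_gt0 {S} => // k _ /=.
rewrite -[(2 ^ k).+1%:R]natr1 natrX; elim: k => [|k IHk];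
  first by rewrite expr1 expr0; lra.
rewrite exprS [2 ^+ k.+1]exprS;
  have : 1 <= 2 ^+ k :> R by rewrite exprn_ege1// ler1n.
by move: IHk; set u := (32 / 25) ^+ _; set v := 2 ^+ _; lra.
Qed.

(** Otherwise each fibre of f lies in a Hamming ball of radius m/2, which has at most 2^m #|A|^(m/2)
    words; summing over the #|B| fibres contradicts the size assumption. *)
Lemma exists_far_words (R : realType) (A B : finType) (m : nat)
    (f : {ffun 'I_m -> A} -> B) :
  (0 < #|A|)%N -> ((#|B| * 2 ^ m) ^ 2 < #|A| ^ m)%N ->
  exists w w', f w = f w' /\ (m < 2 * #|[pred i | w i != w' i]|)%N.
Proof.
move=> A0 BA; pose a : R := #|A|%:R.
have a0 : 0 < a by rewrite ltr0n.
have a1 : 1 <= a by rewrite ler1n.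
have lna0 : 0 <= ln a by rewrite ln_ge0.
(* The power #|A|^(m/2), written as an exponential because m may be odd. *)
pose E : R := expR (ln a * (m%:R / 2)).
have E2 : E ^+ 2 = a ^+ m.
  rewrite -expRM_natl -[in RHS](lnK (x := a)) ?posrE// -expRM_natl.
  by congr expR; field.
have E0 : 0 < E by exact: expR_gt0.
have BE : #|B|%:R * 2 ^+ m < E.
  rewrite -(ltr_pXn2r (n := 2))// ?nnegrE ?mulr_ge0 ?exprn_ge0 ?(ltW E0)//.
  by rewrite E2 -!natrX -natrM -natrX ltr_nat.
have ball_le w : #|[pred w' : {ffun 'I_m -> A} |
    (2 * #|[pred i | w i != w' i]| <= m)%N]|%:R <= E * 2 ^+ m.
  (* Chernoff's bound with parameter ln #|A|: the letter of w contributes 1 and the others 1/#|A|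
     each, so every coordinate gives a factor at most 2. *)
  pose g (i : 'I_m) b : R := ln a * (w i != b)%:R.
  apply: (@le_trans _ _ #|[pred w' : {ffun 'I_m -> A} |
      \sum_i g i (w' i) <= ln a * (m%:R / 2)]|%:R).
    rewrite ler_nat; apply/subset_leq_card/fintype.subsetP => w'.
    rewrite !inE => h.
    rewrite -mulr_sumr ler_wpM2l// -natr_sum ler_pdivlMr// -natrM ler_nat.
    by rewrite mulnC -sum1_card big_mkcond in h *.
  apply: (le_trans (card_sum_le _ _)); rewrite ler_pM2l//.
  apply: (@le_trans _ _ (\prod_(i < m) 2)); last first.
    by rewrite prodr_const card_ord.
  apply: ler_prod => i _; rewrite sumr_ge0/=; last by move=> b _;
    exact: expR_ge0.
  rewrite (bigD1 (w i))//= /g eqxx mulr0 oppr0 expR0 -[leRHS]natr1 lerD2l.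
  apply: (@le_trans _ _ (\sum_(b : A) a^-1)).
    rewrite [leRHS](bigID (fun b => b != w i))/= -[leLHS]addr0 lerD//.
      apply: ler_sum => b bw; rewrite eq_sym bw mulr1 expRN lnK//.
    by rewrite sumr_ge0// => b _; rewrite invr_ge0 ltW.
  by rewrite sumr_const -mulr_natl mulfV ?gt_eqF.
apply: contrapT => far; suff : a ^+ m <= #|B|%:R * (E * 2 ^+ m).
  by apply/negP; rewrite -ltNge mulrCA -E2 expr2 ltr_pM2l.
have -> : a ^+ m = #|{ffun 'I_m -> A}|%:R by rewrite card_ffun card_ord natrX.
rewrite -sum1_card natr_sum.
rewrite (partition_big f xpredT)//= mulr_natl -[#|B|]/(#|xpredT|) -sumr_const.
apply: ler_sum => b _; rewrite -natr_sum sum1_card.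
have [w /eqP fw|none] := pickP (fun w => f w == b); last first.
  by rewrite eq_card0 ?mulr_ge0 ?exprn_ge0// ltW.
apply: le_trans (ball_le w); rewrite ler_nat.
apply/subset_leq_card/fintype.subsetP => w'; rewrite !inE => /eqP fw'.
by rewrite leqNgt; apply/negP => h; apply: far; exists w, w'; rewrite fw fw'.
Qed.

(** * Upper bound *)

Section Coordinates.
Context {R : realType} {p : R} {M1 M2 : R -> R}.
Hypothesis p_gt0 : 0 < p.
Hypotheses (M1_Orlicz : p_Orlicz_function p M1)
           (M2_Orlicz : p_Orlicz_function p M2).
Hypothesis ratio_nondecreasing :
  {in `[1, +oo[ &, {homo (fun t : R =>
    fundamental_function M1 t / fundamental_function M2 t)
    : s t / s <= t}}.

Let J1 := Orlicz_inverse M1.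
Let J2 := Orlicz_inverse M2.

(** The monotonicity of the ratio at 1/s' <= 1/s, cleared of denominators. *)
Lemma inverse_ratio_le (s s' : R) : 0 < s -> s <= s' -> s' <= 1 ->
  J2 s' * J1 s <= J2 s * J1 s'.
Proof.
move=> s0 ss' s'1; have s'0 : 0 < s' by exact: lt_le_trans ss'.
have s1 : s <= 1 by exact: le_trans s'1.
have := ratio_nondecreasing (x := s'^-1) (y := s^-1).
rewrite !in_itv/= !andbT !invf_ge1// lef_pV2 ?posrE// => /(_ s'1 s1 ss').
rewrite /fundamental_function !div1r !invrK -/(Orlicz_inverse _ _) -/J1 -/J2.
rewrite ![_^-1 * _]mulrC ler_pdivrMr ?(Orlicz_inverse_gt0 p_gt0 M1_Orlicz)//.
by rewrite mulrAC ler_pdivlMr ?(Orlicz_inverse_gt0 p_gt0 M1_Orlicz).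
Qed.

(** * Estimates for a single coordinate *)

Section Coordinate.
Context {A C a s x : R}.
Hypotheses (A_gt0 : 0 < A) (C_ge1 : 1 <= C) (a_ge0 : 0 <= a).
Hypotheses (s_gt0 : 0 < s) (s_le1 : s <= 1) (x_ge0 : 0 <= x) (x_le1 : x <= 1).
Hypothesis aJ : a * J1 s <= A * J2 s.
Let c := C `^ p^-1.

Let J1s_gt0 : 0 < J1 s.
Proof. exact: (Orlicz_inverse_gt0 p_gt0 M1_Orlicz). Qed.

Let J2s_gt0 : 0 < J2 s.
Proof. exact: (Orlicz_inverse_gt0 p_gt0 M2_Orlicz). Qed.

Let c_ge1 : 1 <= c.
Proof.
have := @ge0_ler_powR _ p^-1 _ 1 C; rewrite powR1 invr_ge0 ltW//; apply => //;
by rewrite nnegrE// (le_trans ler01).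
Qed.

Let c_gt0 : 0 < c. Proof. exact: lt_le_trans c_ge1. Qed.

Let M1x_ge0 : 0 <= M1 x.
Proof. exact: (Orlicz_ge0 p_gt0 M1_Orlicz). Qed.

Let M1x_le1 : M1 x <= 1.
Proof. exact: (Orlicz_le1 p_gt0 M1_Orlicz). Qed.

(** As x <= J1 (M1 x), [inverse_ratio_le] carries the bound [aJ] from the level s down to the level
    M1 x. *)
Lemma diagonal_coord_le : M1 x <= s -> a * x <= A * J2 (M1 x).
Proof.
move=> xs; have [j0 j1 Mj] := Orlicz_inverse_itv p_gt0 M2_Orlicz M1x_ge0
  M1x_le1.
move: x_ge0; rewrite le_eqVlt => /predU1P[x0|x0].
  by rewrite -{1}x0 mulr0 mulr_ge0// ltW.
have Mx0 : 0 < M1 x.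
  by rewrite -(Orlicz0 p_gt0 M1_Orlicz); exact: (Orlicz_lt p_gt0 M1_Orlicz).
have xE : x <= J1 (M1 x).
  by rewrite -(Orlicz_le_inverse p_gt0 M1_Orlicz)// ltW.
rewrite -(ler_pM2r J1s_gt0) mulrAC.
apply: le_trans (ler_wpM2r x_ge0 aJ) _.
rewrite -!mulrA ler_pM2l//; apply: le_trans (inverse_ratio_le Mx0 xs s_le1).
by rewrite ler_pM2l.
Qed.

(** If M1 x <= s, the bound err <= a x and [diagonal_coord_le] suffice. If M1 x > s, the bound by A
    c J2(s) gives modular at most s. *)
Lemma diagonal_error_le (err : R) : 0 <= err -> err <= a * x ->
  err <= A * c * J2 s -> err / (A * c) <= 1 /\ M2 (err / (A * c)) <= M1 x.
Proof.
move=> err0 errx errs; have Ac : 0 < A * c by rewrite mulr_gt0.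
have z0 : 0 <= err / (A * c) by rewrite divr_ge0// ltW.
have [xs|sx] := leP (M1 x) s; last first.
  have [j0 j1 Mj] := Orlicz_inverse_itv p_gt0 M2_Orlicz (ltW s_gt0) s_le1.
  have zs : err / (A * c) <= J2 s by rewrite ler_pdivrMr// mulrC.
  have z1 := le_trans zs j1; split=> //.
  rewrite (le_trans _ (ltW sx))// (Orlicz_le_inverse p_gt0 M2_Orlicz)//.
  exact: ltW.
have [j0 j1 Mj] := Orlicz_inverse_itv p_gt0 M2_Orlicz M1x_ge0 M1x_le1.
have zx : err / (A * c) <= J2 (M1 x).
  rewrite ler_pdivrMr// (le_trans errx)// (le_trans (diagonal_coord_le xs))//.
  by rewrite mulrC ler_wpM2l// ler_peMr// ltW.
have z1 := le_trans zx j1; split=> //.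
by rewrite (Orlicz_le_inverse p_gt0 M2_Orlicz).
Qed.

(** For g > 0, [aJ] turns the premise into J1(s) <= (g^p C)^(-1/p) x, and [Orlicz_scale] takes the
    factor out of M1. *)
Lemma diagonal_code_le (g : nat) : g%:R * (A * c * J2 s) <= a * x ->
  g%:R `^ p * (C * s) <= M1 x.
Proof.
move=> gx; have [->|g_gt0] := posnP g; first by rewrite powR0 ?gt_eqF// mul0r.
have g0 : 0 < g%:R :> R by rewrite ltr0n.
have C0 : 0 < C by exact: lt_le_trans C_ge1.
have sx : s <= M1 x.
  rewrite leNgt; apply/negP => xs; move: (xs); rewrite ltNge => /negP; apply.
  have [j0 j1 Mj] := Orlicz_inverse_itv p_gt0 M2_Orlicz (ltW s_gt0) s_le1.
  rewrite -Mj (Orlicz_le_inverse p_gt0 M2_Orlicz)// -(ler_pM2l A_gt0).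
  apply: le_trans (diagonal_coord_le (ltW xs)).
  apply: le_trans gx; rewrite mulrA ler_pM2r// mulrCA ler_peMr ?(ltW A_gt0)//.
  by rewrite mulr_ege1// ler1n.
have a0 : 0 < a.
  rewrite lt0r a_ge0 andbT; apply: contraTneq gx => ->.
  by rewrite mul0r -ltNge !mulr_gt0.
have gcx : J1 s <= (g%:R `^ p * C)^-1 `^ p^-1 * x.
  rewrite -powR_inv1 ?mulr_ge0 ?powR_ge0 ?(ltW C0)// -powRrM mulN1r powRN.
  rewrite powRM ?powR_ge0 ?(ltW C0)// -powRrM mulfV ?gt_eqF// powRr1 ?(ltW
    g0)//.
  rewrite [leRHS]mulrC ler_pdivlMr ?mulr_gt0// -(ler_pM2l a0);
    apply: le_trans gx.
  rewrite -/c (_ : a * _ = g%:R * c * (a * J1 s)); last by ring.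
  rewrite (_ : g%:R * (A * c * J2 s) = g%:R * c * (A * J2 s)); last by ring.
  by rewrite ler_pM2l// mulr_gt0.
have gC : 1 <= g%:R `^ p * C.
  rewrite mulr_ege1//; have := @ge0_ler_powR _ p (ltW p_gt0) 1 g%:R.
  by rewrite powR1; apply; rewrite ?nnegrE ?ler1n// ler0n.
have gC0 := lt_le_trans ltr01 gC.
rewrite mulrA mulrC -ler_pdivlMr// mulrC.
have [j0 j1 Mj] := Orlicz_inverse_itv p_gt0 M1_Orlicz (ltW s_gt0) s_le1.
rewrite -[leLHS]Mj; have h := Orlicz_scale p_gt0 M1_Orlicz.
apply: le_trans (h (g%:R `^ p * C)^-1 _ _ _ _ _);
  rewrite ?invr_ge0 ?invf_le1 ?(ltW gC0)//.
apply: (Orlicz_le p_gt0 M1_Orlicz) => //.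
rewrite mulr_ile1 ?powR_ge0// powR_le1 ?invr_ge0 ?invf_le1 ?(ltW gC0)//.
exact: ltW.
Qed.

End Coordinate.

End Coordinates.

(** * Sizes of the levels and the inequalities encoded by Theta *)

Lemma leq_exp2_pred (k : nat) : (0 < k)%N -> (k <= 2 ^ k.-1)%N.
Proof. by case: k => // k _; rewrite ltn_expl. Qed.

Lemma log2_natX (R : realType) (k : nat) : log2 (2 ^+ k) = k%:R :> R.
Proof. by rewrite /log2 lnXn// mulrnAl divff ?gt_eqF ?ln2_gt0. Qed.

Lemma log2_le (R : realType) (x y : R) : 0 < x -> x <= y -> log2 x <= log2 y.
Proof.
move=> x0 xy; rewrite ler_pM2r ?invr_gt0 ?ln2_gt0// ler_ln// posrE//.
exact: lt_le_trans xy.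
Qed.

(** This keeps s_i in (0, 1], where the inverses are meaningful. *)
Lemma level_le (R : realType) (k i : nat) : (0 < k)%N -> (i < 2 ^ k.-1)%N ->
  level R k i <= k%:R.
Proof.
move=> k_gt0 ik; rewrite -[leRHS]log2_natX; apply: log2_le.
  by rewrite divr_gt0 ?mulr_gt0 ?ltr0n// leq_max.
rewrite -[in leRHS](prednK k_gt0) exprS -mulrA ler_pM2l//.
rewrite ler_pdivrMr ?ltr0n// -natrX -natrM ler_nat.
by rewrite (leq_trans (_ : _ <= 2 ^ k.-1)%N) ?leq_pmulr// geq_max ik
  leq_exp2_pred.
Qed.

Lemma exp4_le_exp8 (k : nat) : (k ^ 4 <= 8 ^ k)%N.
Proof.
elim: k => // -[//|[//|[//|k]]] IHk.
rewrite [X in (_ <= X)%N]expnS; apply: leq_trans (leq_mul (leqnn 8) IHk).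
(* From 3 on, passing to the next integer at most doubles the square, hence at most quadruples the
   fourth power. *)
apply: (@leq_trans ((2 * k.+3 ^ 2) ^ 2)); last by rewrite expnMn -expnM leq_mul.
by rewrite (expnM _ 2 2) leq_exp2r// !expnS !expn0 !muln1; nia.
Qed.

(** At n = 2^(k-1) the level is k - log2 k, and k^4 <= 8^k says log2 k <= 3k/4. The resulting s >=
    1/4 serves the coordinates beyond 2^(k-1). *)
Lemma level_last_ge (R : realType) (k : nat) : (0 < k)%N ->
  k%:R / 4 <= level R k (2 ^ k.-1).-1.
Proof.
move=> k_gt0; have k0 : 0 < k%:R :> R by rewrite ltr0n.
rewrite /level prednK ?expn_gt0// (maxn_idPl (leq_exp2_pred k_gt0)).
rewrite natrX -exprS prednK// /log2 ler_pdivlMr ?ln2_gt0//.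
rewrite ln_div ?posrE ?exprn_gt0// lnXn//.
have : ln (k%:R ^+ 4) <= ln (8 ^+ k) :> R.
  by rewrite ler_ln ?posrE ?exprn_gt0// -!natrX ler_nat exp4_le_exp8.
rewrite !lnXn// (_ : 8 = 2 ^+ 3 :> R) ?lnXn//; last by ring.
rewrite -(mulr_natr (ln k%:R)) -(mulr_natr (_ *+ 3)) -(mulr_natr (ln 2) 3).
rewrite -(mulr_natr (ln 2) k); move: (ln 2) (ln k%:R) => a b.
lra.
Qed.

Lemma Theta_ge (R : realType) (p : R) (M1 M2 : R -> R) (alpha : nat -> R)
    (k n : nat) : 0 < p -> p_Orlicz_function p M1 -> p_Orlicz_function p M2 ->
  (0 < k)%N -> (k <= n <= 2 ^ k.-1)%N ->
  alpha n.-1 * Orlicz_inverse M1 (level R k n.-1 / k%:R) <=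
  Theta M1 M2 alpha k * Orlicz_inverse M2 (level R k n.-1 / k%:R).
Proof.
move=> p0 hM1 hM2 k_gt0 /andP[kn nk].
have n_gt0 : (0 < n)%N by exact: leq_trans kn.
have k0 : 0 < k%:R :> R by rewrite ltr0n.
have l1 : 1 <= level R k n.-1 by exact: level_ge1.
have s1 : level R k n.-1 / k%:R <= 1.
  by rewrite ler_pdivrMr// mul1r level_le// prednK.
have s0 : 0 < level R k n.-1 / k%:R by rewrite divr_gt0// (lt_le_trans _ l1).
rewrite -ler_pdivrMr ?(Orlicz_inverse_gt0 p0 hM2)//.
apply: le_trans (le_bigmax_seq _ n _ _ _ _) => //; last first.
  by rewrite mem_index_iota kn ltnS nk.
rewrite /= /fundamental_function.
have -> : log2 (2 * n%:R / k%:R) = level R k n.-1.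
  by rewrite /level prednK// (maxn_idPl kn).
rewrite !div1r invf_div invrK -/(Orlicz_inverse _ _) -/(Orlicz_inverse M1 _).
by rewrite [_^-1 * _]mulrC mulrA.
Qed.

(** Below k the level is that of n = k, and alpha is at most its first term, which equals its
    k-th. *)
Lemma alpha_level_le (R : realType) (p : R) (M1 M2 : R -> R) (alpha : nat -> R)
    (k i : nat) : 0 < p -> p_Orlicz_function p M1 -> p_Orlicz_function p M2 ->
  (0 < k)%N -> nonincreasing_seq alpha -> alpha 0%N = alpha k.-1 ->
  (i < 2 ^ k.-1)%N ->
  alpha i * Orlicz_inverse M1 (level R k i / k%:R) <=
  Theta M1 M2 alpha k * Orlicz_inverse M2 (level R k i / k%:R).
Proof.
move=> p0 hM1 hM2 k_gt0 alpha_dec alpha_1k ik.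
have [ki|ik1] := leqP k i.+1.
  by have := Theta_ge alpha p0 hM1 hM2 k_gt0 (n := i.+1); rewrite ki ik; apply.
have -> : level R k i = level R k k.-1.
  by rewrite /level prednK// maxnn (maxn_idPr (ltnW ik1)).
have := Theta_ge alpha p0 hM1 hM2 k_gt0 (n := k).
rewrite leqnn leq_exp2_pred// => /(_ isT); apply: le_trans.
rewrite ler_wpM2r//; last by rewrite -alpha_1k alpha_dec.
have l1 : level R k k.-1 <= k%:R.
  by rewrite level_le// prednK// leq_exp2_pred.
have [] := @Orlicz_inverse_itv _ _ _ p0 hM1 (level R k k.-1 / k%:R) => //.
  by rewrite divr_ge0// (le_trans ler01)// level_ge1.
by rewrite ler_pdivrMr ?ltr0n// mul1r.
Qed.

(** For the centres of the covering, which must lie in the target space. *)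
Lemma Orlicz_space_finsupp (R : realType) (p : R) (M : R -> R) (N : nat)
    (y : nat -> R) : 0 < p -> p_Orlicz_function p M ->
  (forall i, (N <= i)%N -> y i = 0) -> Orlicz_space M y.
Proof.
move=> p0 hM yN; pose rho := 1 + \sum_(i < N) `|y i|.
have sum0 : 0 <= \sum_(i < N) `|y i| by rewrite sumr_ge0.
have rho0 : 0 < rho by rewrite /rho; lra.
have yrho i : `|y i| <= rho.
  have [iN|Ni] := ltnP i N; last by rewrite yN// normr0 ltW.
  rewrite /rho (bigD1 (Ordinal iN))//=.
  have : 0 <= \sum_(j < N | j != Ordinal iN) `|y j| by rewrite sumr_ge0.
  lra.
exists rho => //; apply: (@le_lt_trans _ _ N%:R%:E); last by rewrite ltry.
apply/(Orlicz_modular_le p0 hM) => //; split=> // n.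
apply: (@le_trans _ _ (\sum_(i < n) (i < N)%:R)).
  apply: ler_sum => i _; have [iN|Ni] := ltnP i N.
    rewrite (Orlicz_le1 p0 hM)// ?divr_ge0 ?(ltW rho0)//.
    by rewrite ler_pdivrMr// mul1r.
  by rewrite yN// normr0 mul0r (Orlicz0 p0 hM).
rewrite -natr_sum ler_nat; have -> : (\sum_(i < n) (i < N) = minn n N)%N.
  elim: n => [|n IHn]; first by rewrite big_ord0 min0n.
  by rewrite big_ord_recr/= IHn; lia.
exact: geq_minr.
Qed.

Definition code_val (R : realType) (n : nat) (a : option ('I_n * bool)) : R :=
  if a is Some (j, b) then (-1) ^+ b * j.+1%:R else 0.

(** Rounding towards 0, so that the error is at most |x| as well as at most 1. Valid when |x| has
    integer part at most n, since [inord] needs a bound. *)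
Definition encode (R : realType) (n : nat) (x : R) : option ('I_n.+1 * bool) :=
  if Num.trunc `|x| is g.+1 then Some (inord g, x < 0) else None.

Lemma encodeP (R : realType) (n : nat) (x : R) : (Num.trunc `|x| <= n)%N ->
  [/\ code_abs R (encode n x) = (Num.trunc `|x|)%:R,
      `|x - code_val R (encode n x)| <= `|x| &
      `|x - code_val R (encode n x)| <= 1].
Proof.
move=> xn; rewrite /encode; have := truncn_itv (normr_ge0 x).
case E : (Num.trunc `|x|) xn => [|g] gn /andP[gx xg] /=.
  by split; rewrite ?subr0// ltW.
rewrite inordK; last exact: ltnW.
have -> : `|x - (-1) ^+ (x < 0)%R * g.+1%:R| = `|x| - g.+1%:R.
  have [x0|x0] := ltrP x 0.
    rewrite expr1 mulN1r opprK ler0_norm.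
      by rewrite ltr0_norm//; ring.
    by move: gx; rewrite ltr0_norm//; lra.
  rewrite expr0 mul1r ger0_norm; first by rewrite ger0_norm.
  by move: gx; rewrite ger0_norm//; lra.
split=> //; first by rewrite gerBl ler0n.
by move: xg; rewrite -[g.+2%:R]natr1; lra.
Qed.

(** A positive A stands in for Theta, which may vanish. The factor 2 comes from the halving in
    [Orlicz_ball_modular_le1]. *)
Lemma diagonal_entropy_le (R : realType) (p A : R) (M1 M2 : R -> R) (k : nat)
    (alpha : nat -> R) :
  0 < p -> p <= 1 -> p_Orlicz_function p M1 -> p_Orlicz_function p M2 ->
  {in `[1, +oo[ &, {homo (fun t : R =>
    fundamental_function M1 t / fundamental_function M2 t) : s t / s <= t}} ->
  (0 < k)%N -> (forall i, 0 <= alpha i) -> nonincreasing_seq alpha ->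
  alpha 0%N = alpha k.-1 -> 0 < A -> Theta M1 M2 alpha k <= A ->
  (diagonal_entropy M1 M2 alpha k <= (2 * (A * (64 / p) `^ p^-1))%:E)%E.
Proof.
move=> p0 p1 hM1 hM2 ratio k_gt0 alpha0 alpha_dec alpha_1k A0 ThetaA.
have k0 : 0 < k%:R :> R by rewrite ltr0n.
set C := 64 / p; set c := C `^ p^-1.
have C64 : 64 <= C by rewrite /C ler_pdivlMr//; lra.
have C1 : 1 <= C by lra.
have C0 : 0 < C by lra.
have c0 : 0 < c by rewrite powR_gt0.
set N := (2 ^ k.-1)%N; pose s i := level R k i / k%:R.
have s0 i : 0 < s i by rewrite divr_gt0// (lt_le_trans ltr01)// level_ge1.
have s1 i : (i < N)%N -> s i <= 1.
  by move=> iN; rewrite ler_pdivrMr// mul1r level_le.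
pose J1 := Orlicz_inverse M1; pose J2 := Orlicz_inverse M2.
have J1_gt0 := Orlicz_inverse_gt0 p0 hM1;
  have J2_gt0 := Orlicz_inverse_gt0 p0 hM2.
have aJ i : (i < N)%N -> alpha i * J1 (s i) <= A * J2 (s i).
  move=> iN; apply: le_trans (alpha_level_le p0 hM1 hM2 k_gt0 alpha_dec
    alpha_1k iN) _.
  by rewrite ler_pM2r// J2_gt0 ?s0 ?s1.
pose u i := A * c * J2 (s i).
have u0 i : (i < N)%N -> 0 < u i by move=> iN;
  rewrite !mulr_gt0// J2_gt0 ?s0 ?s1.
(* As |x i| <= 1, this bounds every rounded quotient and makes the set of codes finite. *)
pose G := (\max_(i < N) Num.trunc (alpha i / u i))%N.
pose code := option ('I_G.+1 * bool).
(* The factor 2 undoes the passage from X to x = X / 2. *)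
pose center (w : {ffun 'I_N -> code}) (i : nat) : R :=
  if insub i is Some j then 2 * (code_val R (w j) * u i) else 0.
pose S := [pred w : {ffun 'I_N -> code} |
  \sum_i code_abs R (w i) `^ p * level R k i <= k%:R * p / 64].
have SN : (#|S| <= N)%N by exact: card_codes.
pose w0 : {ffun 'I_N -> code} := [ffun=> None].
apply: ereal_inf_lbound; exists (2 * (A * c)) => //; split.
  by rewrite !mulr_gt0.
(* [S] may have fewer than [N] elements; surplus indices get the centre of [w0], which is 0. *)
exists (fun j : 'I_N => center (nth w0 (enum S) j)); split=> [j|].
  apply: (Orlicz_space_finsupp (N := N) p0 hM2) => i Ni.
  by rewrite /center insubF// ltnNge Ni.
move=> _ [X /(Orlicz_ball_modular_le1 p0 hM1)[X1 sumX] <-].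
pose x i : R := X i / 2.
pose w : {ffun 'I_N -> code} := [ffun i : 'I_N => encode G (alpha i * x i / u
  i)].
have truncG (i : 'I_N) : (Num.trunc `|alpha i * x i / u i| <= G)%N.
  apply: leq_trans (leq_bigmax i); apply: le_truncn.
  rewrite normrM [`|(u i)^-1|]gtr0_norm ?invr_gt0 ?u0// ler_pM2r ?invr_gt0
    ?u0//.
  by rewrite normrM ger0_norm// ler_piMr// X1.
(* By [diagonal_code_le], |g_i|^p C s_i <= M1 |x i|; multiply by k / C and sum, the right-hand sides
   adding up to at most 1. *)
have wS : w \in S.
  rewrite inE; apply: (@le_trans _ _ (\sum_(i < N) M1 `|x i| * (k%:R / C))).
    apply: ler_sum => i _; rewrite ffunE; have [-> _ _] := encodeP (truncG i).
    rewrite -ler_pdivrMr ?divr_gt0// invf_div.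
    set g := Num.trunc _.
    have gx : g%:R * (A * c * J2 (s i)) <= alpha i * `|x i|.
      have /andP[+ _] := truncn_itv (normr_ge0 (alpha i * x i / u i)).
      rewrite -/g normrM [`|(u i)^-1|]gtr0_norm ?invr_gt0 ?u0//.
      by rewrite ler_pdivlMr ?u0// normrM ger0_norm.
    have := diagonal_code_le p0 hM1 hM2 ratio A0 C1 (alpha0 i) (s0 i)
      (s1 i (ltn_ord i)) (normr_ge0 (x i)) (X1 i) (aJ i (ltn_ord i)) gx.
    apply: le_trans; rewrite /s (_ : _ * (C / _) = g%:R `^ p * (C * (level R k
      i / k%:R)))//.
    by ring.
  rewrite -mulr_suml (_ : k%:R * p / 64 = 1 * (k%:R / C)).
    by rewrite ler_wpM2r ?sumX// divr_ge0// ltW.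
  by rewrite /C; field; rewrite gt_eqF.
have jN : (index w (enum S) < N)%N.
  by apply: leq_trans SN; rewrite cardE index_mem mem_enum.
exists (Ordinal jN) => //=; rewrite nth_index ?mem_enum//.
exists (fun i => (alpha i * X i - center w i) / (2 * (A * c))); last first.
  apply/funext => i; rewrite /diagonal_operator.
  transitivity (center w i + 2 * (A * c) * ((alpha i * X i - center w i) / (2 *
    (A * c)))) => //.
  by field; rewrite !gt_eqF.
have err i : `|(alpha i * X i - center w i) / (2 * (A * c))| <= 1 /\
    M2 `|(alpha i * X i - center w i) / (2 * (A * c))| <= M1 `|x i|.
  have Ac : 0 < A * c by rewrite mulr_gt0.
  have [iN|Ni] := ltnP i N; last first.
    rewrite /center insubF ?ltnNge ?Ni// subr0.
    have -> : `|alpha i * X i / (2 * (A * c))| = alpha i * `|x i| / (A * c).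
      rewrite (_ : _ / (2 * (A * c)) = alpha i * x i / (A * c)); last first.
        by rewrite /x; field; rewrite !gt_eqF.
      by rewrite normrM [`|alpha i * _|]normrM (ger0_norm (alpha0 i))
        (gtr0_norm (x := _^-1)) ?invr_gt0.
    (* Beyond [N] the error is the whole coordinate. It is estimated at the last level, where s >=
       1/4 >= 1/C gives c J1(s) >= 1. *)
    have N1 : (N.-1 < N)%N by rewrite prednK// expn_gt0.
    have ai : alpha i * J1 (s N.-1) <= A * J2 (s N.-1).
      apply: le_trans (aJ _ N1); rewrite ler_pM2r ?J1_gt0 ?s0 ?s1//.
      by apply: alpha_dec; rewrite (leq_trans _ Ni)// leq_pred.
    have H := diagonal_error_le p0 hM1 hM2 ratio A0 C1 (s0 N.-1)
      (s1 _ N1) (normr_ge0 (x i)) (X1 i) ai.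
    apply: (H (alpha i * `|x i|)) => //; first by rewrite mulr_ge0.
    have s4 : 1 / 4 <= s N.-1.
      by rewrite ler_pdivlMr// mulrAC mul1r level_last_ge.
    have J4 : c^-1 <= J1 (s N.-1).
      have J11 : 1 <= J1 1.
        by rewrite -(Orlicz_le_inverse p0 hM1)// (Orlicz1 hM1).
      have CV1 : C^-1 <= 1 by rewrite invf_le1.
      have CV0 : 0 <= C^-1 by rewrite invr_ge0 ltW.
      apply: (@le_trans _ _ (J1 (C^-1 * 1))); last first.
        rewrite mulr1; apply: (Orlicz_inverse_le p0 hM1) => //; last exact: s1.
        by apply: le_trans s4; rewrite div1r lef_pV2 ?posrE//; lra.
      apply: le_trans (Orlicz_inverse_scale p0 hM1 _ _ _ _) => //.
      have -> : C^-1 `^ p^-1 = c^-1.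
        by rewrite -powR_inv1 ?ltW// -powRrM mulN1r powRN.
      by rewrite ler_peMr// invr_ge0 ltW.
    apply: (@le_trans _ _ (alpha i)); first by rewrite ler_piMr// X1.
    apply: (@le_trans _ _ (alpha i * J1 (s N.-1) * c)).
      by rewrite -mulrA ler_peMr// -ler_pdivrMr// div1r.
    by rewrite -/c [leRHS]mulrAC ler_pM2r.
  rewrite /center insubT/= ffunE; set v := code_val R _.
  have [_ vx v1] := encodeP (truncG (Ordinal iN)); rewrite -/v /= in vx v1.
  have ui := u0 i iN.
  have -> : `|(alpha i * X i - 2 * (v * u i)) / (2 * (A * c))| =
      u i * `|alpha i * x i / u i - v| / (A * c).
    rewrite (_ : _ / (2 * (A * c)) = u i * (alpha i * x i / u i - v) / (A *
      c)); last first.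
      by rewrite /x; field; rewrite !gt_eqF.
    by rewrite normrM [`|u i * _|]normrM (gtr0_norm ui)
      (gtr0_norm (x := _^-1)) ?invr_gt0.
  apply: (diagonal_error_le p0 hM1 hM2 ratio A0 C1 (s0 i) (s1 _ iN)
    (normr_ge0 (x i)) (X1 i) (aJ i iN)).
  - by rewrite mulr_ge0// ltW.
  - rewrite mulrC -ler_pdivlMr// (le_trans vx)// normrM [`|alpha i * _|]normrM
    (ger0_norm (alpha0 i)).
    by rewrite [`|(u i)^-1|]gtr0_norm ?invr_gt0.
  - by rewrite -/(u i) ler_piMr// ltW.
apply: (Orlicz_ballP p0 hM2) => [i|n]; first by case: (err i).
apply: le_trans (sumX n); apply: ler_sum => i _; exact: (err i).2.
Qed.

(** * Lower bound *)

(* The first component of [w j] is the position inside block j, the second one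
   the height in {1/16, .., 16/16}. *)
Definition word_seq (R : realType) (m b : nat) (v : R)
    (w : {ffun 'I_m -> 'I_b * 'I_16}) (i : nat) : R :=
  if insub (i %/ b)%N is Some j then
    if (i %% b)%N == (w j).1 then (w j).2.+1%:R / 16 * v else 0
  else 0.

Lemma word_seq_block (R : realType) (m b : nat) (v : R)
    (w : {ffun 'I_m -> 'I_b * 'I_16}) (j : 'I_m) (r : 'I_b) :
  word_seq v w (j * b + r) = if r == (w j).1 then (w j).2.+1%:R / 16 * v else 0.
Proof.
have b0 : (0 < b)%N by case: b r {w} => [[]|].
rewrite /word_seq divnMDl// divn_small// addn0 modnMDl modn_small//.
by rewrite valK.
Qed.

Lemma word_seq_itv (R : realType) (m b : nat) (v : R)
    (w : {ffun 'I_m -> 'I_b * 'I_16}) (i : nat) : 0 <= v ->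
  0 <= word_seq v w i <= v.
Proof.
move=> v0; rewrite /word_seq; case: insubP => [j _ _|_]; last by rewrite lexx.
case: ifP => _; last by rewrite lexx.
rewrite mulr_ge0 ?divr_ge0//= ler_piMl// ler_pdivrMr// mul1r ler_nat.
exact: ltn_ord.
Qed.

Lemma sum_eqn_le1 (n c : nat) : (\sum_(i < n) (i == c :> nat) <= 1)%N.
Proof.
have -> : (\sum_(i < n) (i == c :> nat) = (c < n))%N; last by case: ltnP.
elim: n => [|n IHn]; first by rewrite big_ord0.
by rewrite big_ord_recr/= IHn; lia.
Qed.

(** Each of the m blocks has one non-zero entry, of height at most v, and M v = 1/m. *)
Lemma word_seq_ball (R : realType) (p : R) (M : R -> R) (m b : nat)
    (w : {ffun 'I_m -> 'I_b * 'I_16}) : 0 < p -> p_Orlicz_function p M ->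
  (0 < m)%N -> Orlicz_ball M (word_seq (Orlicz_inverse M m%:R^-1) w).
Proof.
move=> p0 hM m_gt0; have m0 : 0 < m%:R :> R by rewrite ltr0n.
set v := Orlicz_inverse M m%:R^-1.
have [v0 v1 Mv] : [/\ 0 <= v, v <= 1 & M v = m%:R^-1].
  apply: (Orlicz_inverse_itv p0 hM); first by rewrite invr_ge0 ltW.
  by rewrite invf_le1// ler1n.
have itv i := word_seq_itv w i v0.
have itv1 i : `|word_seq v w i| = word_seq v w i.
  by rewrite ger0_norm//; case/andP: (itv i).
apply: (Orlicz_ballP p0 hM) => [i|n].
  by rewrite itv1 (le_trans _ v1)//; case/andP: (itv i).
apply: (@le_trans _ _ (\sum_(i < n) \sum_(j < m)
    (i == j * b + (w j).1 :> nat)%N%:R / m%:R)).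
  apply: ler_sum => i _; rewrite itv1.
  have rhs0 (P : pred 'I_m) :
      0 <= \sum_(j < m | P j) (i == j * b + (w j).1 :> nat)%N%:R / m%:R :> R.
    by rewrite sumr_ge0// => j _; rewrite divr_ge0.
  have [->|x0] := eqVneq (word_seq v w i) 0.
    by rewrite (Orlicz0 p0 hM) rhs0.
  have /andP[xi0 xiv] := itv i.
  apply: (@le_trans _ _ m%:R^-1).
    by rewrite -Mv; apply: (Orlicz_le p0 hM).
  move: x0; rewrite /word_seq; case: insubP => [j _ ji|]; last by rewrite eqxx.
  case: ifP => [/eqP ij _|]; last by rewrite eqxx.
  rewrite (bigD1 j)//= -ij ji -divn_eq eqxx mul1r lerDl.
  exact: rhs0.
rewrite exchange_big/=; apply: (@le_trans _ _ (\sum_(j < m) m%:R^-1)).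
  apply: ler_sum => j _; rewrite -mulr_suml -natr_sum ler_piMl ?invr_ge0 ?(ltW
    m0)//.
  by rewrite (ler_nat _ _ 1) sum_eqn_le1.
by rewrite sumr_const card_ord -(mulr_natl m%:R^-1) mulfV// gt_eqF.
Qed.

(** At the position marked by w, either w' vanishes or the heights differ by a non-zero multiple of
    v/16. *)
Lemma word_seq_dist (R : realType) (m b : nat) (v : R)
    (w w' : {ffun 'I_m -> 'I_b * 'I_16}) (j : 'I_m) : 0 <= v -> w j != w' j ->
  v / 16 <= `|word_seq v w (j * b + (w j).1) - word_seq v w' (j * b + (w j).1)|.
Proof.
move=> v0; rewrite !word_seq_block eqxx.
case: (w j) (w' j) => [r l] [r' l'] /=.
have [<-|_ _] := eqVneq r r'; last first.
  rewrite subr0 ger0_norm ?mulr_ge0 ?divr_ge0// mulrAC ler_pM2r ?invr_gt0//.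
  by rewrite ler_peMl// ler1n.
rewrite xpair_eqE eqxx/= => ll'.
rewrite -!mulrBl !normrM (ger0_norm v0) (ger0_norm (x := 16^-1)) ?invr_ge0//.
rewrite mulrAC ler_pM2r ?invr_gt0// ler_peMl// ler_normr; apply/orP.
case: (ltngtP l l') ll' => // [h|h|/val_inj->]; last by rewrite eqxx.
  have : l.+1%:R + 1 <= l'.+1%:R :> R by rewrite natr1 ler_nat.
  by move=> ? _; right; lra.
have : l'.+1%:R + 1 <= l.+1%:R :> R by rewrite natr1 ler_nat.
by move=> ? _; left; lra.
Qed.

(** Two far words share a centre, so their images differ by e (z1 - z2). In some block where they
    differ, |z1 - z2| / 4 has modular at most 4/m, while [word_seq_dist] bounds it below by z; 64 is
    16 * 4. *)
Lemma cover_separation (R : realType) (p e : R) (M1 M2 : R -> R)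
    (alpha : nat -> R) (k m b n : nat) (y : 'I_(2 ^ k.-1) -> nat -> R) :
  0 < p -> p_Orlicz_function p M1 -> p_Orlicz_function p M2 ->
  (forall i, 0 <= alpha i) -> nonincreasing_seq alpha -> 0 < e ->
  (forall x, Orlicz_ball M1 x -> exists j z, Orlicz_ball M2 z /\
     forall i, alpha i * x i = y j i + e * z i) ->
  (0 < m)%N -> (0 < b)%N -> (m * b <= n)%N ->
  ((2 ^ k.-1 * 2 ^ m) ^ 2 < (b * 16) ^ m)%N ->
  let z := alpha n.-1 * Orlicz_inverse M1 m%:R^-1 / (64 * e) in
  z <= 1 /\ M2 z <= 4 / m%:R.
Proof.
move=> p0 hM1 hM2 alpha0 alpha_dec e0 cover m_gt0 b_gt0 mbn large z.
have m0 : 0 < m%:R :> R by rewrite ltr0n.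
set v := Orlicz_inverse M1 m%:R^-1 in z *.
have v0 : 0 <= v.
  have [] // := @Orlicz_inverse_itv _ _ _ p0 hM1 m%:R^-1.
  by rewrite invf_le1// ler1n.
have /choice[f fP] (w : {ffun 'I_m -> 'I_b * 'I_16}) : exists j z,
    Orlicz_ball M2 z /\ forall i, alpha i * word_seq v w i = y j i + e * z i.
  by apply: cover; exact: (word_seq_ball _ p0 hM1).
have [||w [w' [fw far]]] := @exists_far_words R _ _ m f.
- by rewrite card_prod !card_ord muln_gt0 b_gt0.
- by rewrite card_prod !card_ord.
have [z1 [z1B z1E]] := fP w; have [z2 [z2B z2E]] := fP w'; rewrite -fw in z2E.
have [z1b z1s] := Orlicz_ball_modular_le1 p0 hM2 z1B.
have [z2b z2s] := Orlicz_ball_modular_le1 p0 hM2 z2B.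
(* Dividing by 4 puts d below the larger of |z1|/2 and |z2|/2, so its total modular is at most 2. *)
pose d i := `|z1 i - z2 i| / 4.
have d0 i : 0 <= d i by rewrite divr_ge0.
have d_le i : d i <= Num.max `|z1 i / 2| `|z2 i / 2|.
  rewrite /d !normrM (ger0_norm (x := 2^-1)) ?invr_ge0// le_max.
  have := ler_normB (z1 i) (z2 i).
  case: (leP `|z1 i| `|z2 i|) => h h'; apply/orP; [right|left]; lra.
have d1 i : d i <= 1 by rewrite (le_trans (d_le i))// ge_max z1b z2b.
have Md i : M2 (d i) <= M2 `|z1 i / 2| + M2 `|z2 i / 2|.
  have M_ge0 := Orlicz_ge0 p0 hM2; have M_le := Orlicz_le p0 hM2.
  have := d_le i; rewrite le_max => /orP[] h.
    by rewrite (le_trans (M_le _ _ (d0 i) h (z1b i)))// lerDl M_ge0.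
  by rewrite (le_trans (M_le _ _ (d0 i) h (z2b i)))// lerDr M_ge0.
have Md0 i : 0 <= M2 (d i) by rewrite (Orlicz_ge0 p0 hM2).
have idx_lt (j : 'I_m) : (j * b + (w j).1 < m * b)%N.
  apply: (@leq_trans (j.+1 * b)); last by rewrite leq_mul2r ltn_ord orbT.
  by rewrite mulSn addnC ltn_add2r.
pose h (j : 'I_m) : 'I_(m * b) := Ordinal (idx_lt j).
have h_inj : injective h.
  move=> j j' /(congr1 (fun i : 'I_(m * b) => i %/ b)%N) /=.
  by rewrite !divnMDl// !divn_small// !addn0 => /val_inj.
pose D := [pred j | w j != w' j].
have [j jD Mj] : exists2 j, j \in D & M2 (d (h j)) <= 4 / m%:R.
  (* Otherwise more than m/2 distinct positions would each carry more than 4/m, exceeding the total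
     2. *)
  apply: contrapT => none.
  have : \sum_(j in D) M2 (d (h j)) <= 2.
    apply: (@le_trans _ _ (\sum_(i < m * b) M2 (d i))).
      rewrite -(big_imset (fun i : 'I_(m * b) => M2 (d i)))/=; last first.
        by move=> ? ? _ _; exact: h_inj.
      rewrite [leRHS](bigID (mem (h @: D)))/= lerDl sumr_ge0//.
    apply: (@le_trans _ _ (\sum_(i < m * b) (M2 `|z1 i / 2| + M2 `|z2 i / 2|))).
      by apply: ler_sum => i _.
    rewrite big_split/=; have := z1s (m * b)%N; have := z2s (m * b)%N.
    by set u := \sum_(i < _) _; set u' := \sum_(i < _) _; lra.
  apply/negP; rewrite -ltNge.
  apply: (@lt_le_trans _ _ (\sum_(j in D) (4 / m%:R))).
    rewrite sumr_const -(mulr_natr (_ / _)) mulrAC ltr_pdivlMr//.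
    have : m%:R < 2 * #|D|%:R :> R by rewrite -natrM ltr_nat.
    lra.
  apply: ler_sum => j jD; rewrite leNgt; apply/negP => /ltW Mj.
  by apply: none; exists j.
have zd : z <= d (h j).
  have dist := word_seq_dist v0 jD.
  have -> : d (h j) = alpha (h j) *
      `|word_seq v w (h j) - word_seq v w' (h j)| / (4 * e).
    rewrite -[alpha (h j)]ger0_norm// -normrM mulrBr z1E z2E.
    rewrite (_ : _ - _ = e * (z1 (h j) - z2 (h j))); last by ring.
    by rewrite normrM (gtr0_norm e0) /d; field; rewrite gt_eqF.
  rewrite (_ : z = alpha n.-1 * (v / 16) / (4 * e)); last first.
    by rewrite /z; field; rewrite gt_eqF.
  rewrite ler_pM2r ?invr_gt0 ?mulr_gt0// ler_pM// ?divr_ge0//.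
  apply: alpha_dec; rewrite -ltnS prednK.
    by rewrite (leq_trans _ mbn)// ltn_ord.
  by rewrite (leq_trans _ mbn)// muln_gt0 m_gt0.
have z0 : 0 <= z by rewrite /z divr_ge0 ?mulr_ge0 ?(ltW e0).
split; first exact: le_trans zd (d1 _).
exact: le_trans (Orlicz_le p0 hM2 z0 zd (d1 _)) Mj.
Qed.

(** With t = 1/s, m is taken between t and 4t and b = n / m rounded down, which leaves enough words
    for [exists_far_words]. *)
Lemma block_parameters (R : realType) (k n : nat) (s := level R k n.-1 / k%:R) :
  (0 < k)%N -> (k <= n <= 2 ^ k.-1)%N ->
  exists m b : nat, [/\ (0 < m)%N, (0 < b)%N & (m * b <= n)%N] /\
    [/\ ((2 ^ k.-1 * 2 ^ m) ^ 2 < (b * 16) ^ m)%N,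
        m%:R^-1 <= s & 4^-1 * s <= m%:R^-1].
Proof.
have mul4_lt i : (i * 2 + i.+1 * 2 < 4 * i.+1)%N by lia.
have mul16 i j : (8 * (2 * (i * j)) = i * 16 * j)%N by lia.
move=> k_gt0 /andP[kn nk]; have n_gt0 : (0 < n)%N by exact: leq_trans kn.
have k0 : 0 < k%:R :> R by rewrite ltr0n.
have n0 : 0 < n%:R :> R by rewrite ltr0n.
have l1 : 1 <= level R k n.-1 by exact: level_ge1.
have lk : level R k n.-1 <= k%:R by rewrite level_le// prednK.
set l := level R k n.-1 in s l1 lk *.
have l0 : 0 < l by exact: lt_le_trans l1.
have s0 : 0 < s by rewrite divr_gt0.
pose t := k%:R / l.
have ts : s^-1 = t by rewrite invf_div.
have t1 : 1 <= t by rewrite ler_pdivlMr// mul1r.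
have tk : t <= k%:R by rewrite ler_pdivrMr// ler_peMr// ltW.
have /andP[gt tg] := truncn_itv (le_trans ler01 t1).
(* The cap k gives m <= n, hence b > 0; otherwise m = 2 (g + 1) exceeds 2t. *)
set g := Num.trunc t in gt tg; pose m := minn k (2 * g.+1).
have mk : (m <= k)%N by exact: geq_minl.
have m_gt0 : (0 < m)%N by rewrite leq_min k_gt0.
have m0 : 0 < m%:R :> R by rewrite ltr0n.
pose b := (n %/ m)%N.
have b_gt0 : (0 < b)%N by rewrite divn_gt0// (leq_trans mk).
rewrite -natr1 in tg.
have gE : (2 * g.+1)%:R = 2 * (g%:R + 1) :> R by rewrite natrM natr1.
exists m, b; split; first by split=> //; rewrite mulnC leq_divM.
have tm : t <= m%:R.
  by rewrite /m; case: leqP => _ //; rewrite gE; lra.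
have mt : m%:R <= 4 * t.
  apply: (@le_trans _ _ (2 * g.+1)%:R); first by rewrite ler_nat geq_minr.
  by rewrite gE; lra.
split; last 2 first.
- by rewrite -[s]invrK lef_pV2 ?posrE ?invr_gt0// ts.
- by rewrite -[s]invrK -invfM lef_pV2 ?posrE ?mulr_gt0 ?invr_gt0// ts.
(* For m = k the 16 heights suffice: 2^(4k - 2) < 16^k. *)
have [kg|gk] := leqP k (2 * g.+1).
  have -> : m = k by rewrite /m (minn_idPl kg).
  rewrite -expnD -expnM; apply: (@leq_trans ((2 ^ 4) ^ k)); last first.
    by rewrite leq_exp2r// leq_pmull.
  rewrite -expnM ltn_exp2l// mulnDl.
  by case: (k) k_gt0 => // k' _ /=.
have mE : m = (2 * g.+1)%N by rewrite /m (minn_idPr (ltnW gk)).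
(* For m > 2t, x^m >= 4^k because log2 x = k/t; and 16 b >= 4x because n <= 2 b m and m <= k. So (16
   b)^m >= 4^m 4^k. *)
pose x : R := 2 * n%:R / k%:R.
have x0 : 0 < x by rewrite divr_gt0 ?mulr_gt0.
have lx : ln x = l * ln 2.
  rewrite /l /level /log2 prednK// (maxn_idPl kn) mulfVK//.
  by rewrite gt_eqF// ln2_gt0.
have xm : 4 ^+ k <= x ^+ m.
  rewrite -[x]lnK ?posrE// -expRM_natl lx.
  have -> : 4 ^+ k = expR (k%:R * (2 * ln 2)) :> R.
    rewrite expRM_natl expRM_natl lnK ?posrE//; congr (_ ^+ _); ring.
  rewrite ler_expR mulrA mulrA ler_pM2r ?ln2_gt0// mE gE.
  have : k%:R <= (g%:R + 1) * l by rewrite -ler_pdivrMr// ltW.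
  lra.
have bx : 4 * x <= (b * 16)%:R.
  rewrite /x mulrA ler_pdivrMr// mulrA -!natrM ler_nat.
  have nb : (n <= 2 * (b * m))%N.
    rewrite {1}(divn_eq n m) -/b mul2n -addnn leq_add2l ltnW//.
    by rewrite (leq_trans (ltn_pmod n m_gt0))// leq_pmull.
  apply: (@leq_trans (8 * (2 * (b * m)))).
    by rewrite (_ : 4 * 2 = 8)%N// leq_mul2l nb orbT.
  by rewrite mul16 leq_mul2l mk orbT.
suff : ((2 ^ k.-1 * 2 ^ m) ^ 2)%N%:R < ((b * 16) ^ m)%N%:R :> R.
  by rewrite ltr_nat.
rewrite natrX natrM [ltRHS]natrX !natrX exprMn.
apply: (@lt_le_trans _ _ ((4 * x) ^+ m)); last first.
  by rewrite lerXn2r ?nnegrE ?(ltW (mulr_gt0 _ x0))//.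
rewrite exprMn mulrC -!exprM ![(_ * 2)%N]mulnC !exprM.
have -> : 2 ^+ 2 = 4 :> R by ring.
rewrite ltr_pM2l ?exprn_gt0//; apply: lt_le_trans xm.
by rewrite ltr_eXn2l ?prednK// ltr1n.
Qed.

(** The factor q = 4^(-1/p) is lost twice: J1(1/m) >= J1(s/4) >= q J1(s), and M2 (q z) <= M2(z) / 4
    <= 1/m <= s gives q z <= J2(s). *)
Lemma diagonal_entropy_ge (R : realType) (p : R) (M1 M2 : R -> R) (k : nat)
    (alpha : nat -> R) :
  0 < p -> p_Orlicz_function p M1 -> p_Orlicz_function p M2 ->
  (0 < k)%N -> (forall i, 0 <= alpha i) -> nonincreasing_seq alpha ->
  (((4^-1 `^ p^-1) ^+ 2 / 64 * Theta M1 M2 alpha k)%:E <=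
    diagonal_entropy M1 M2 alpha k)%E.
Proof.
move=> p0 hM1 hM2 k_gt0 alpha0 alpha_dec.
have k0 : 0 < k%:R :> R by rewrite ltr0n.
apply/ereal_infP => _ [e [e0 [y [_ cover]]] <-]; rewrite lee_fin.
set q : R := 4^-1 `^ p^-1; have q0 : 0 < q by rewrite powR_gt0.
have q2 : 0 < q ^+ 2 / 64 by rewrite divr_gt0// exprn_gt0.
rewrite mulrC -ler_pdivlMr//.
rewrite /Theta big_nat; apply: bigmax_le => [|n];
  first by rewrite divr_ge0 ?ltW.
rewrite ltnS => nk; have := @block_parameters R k n k_gt0 nk.
have /andP[kn n2k] := nk.
have n_gt0 : (0 < n)%N by exact: leq_trans kn.
have -> : log2 (2 * n%:R / k%:R) = level R k n.-1.
  by rewrite /level prednK// (maxn_idPl kn).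
rewrite /= /fundamental_function !div1r invf_div -/(Orlicz_inverse _ _).
rewrite -/(Orlicz_inverse M1 _) invrK; set s := _ / k%:R.
have s0 : 0 < s by rewrite divr_gt0// (lt_le_trans ltr01)// level_ge1.
have s1 : s <= 1 by rewrite ler_pdivrMr// mul1r level_le// prednK.
have J1s := Orlicz_inverse_gt0 p0 hM1 s0 s1.
have J2s := Orlicz_inverse_gt0 p0 hM2 s0 s1.
move=> [m [b [[m_gt0 b_gt0 mbn] [large ms sm]]]].
have m0 : 0 < m%:R :> R by rewrite ltr0n.
have m1 : m%:R^-1 <= 1 :> R by rewrite invf_le1// ler1n.
have cover' x : Orlicz_ball M1 x -> exists j z, Orlicz_ball M2 z /\
    forall i, alpha i * x i = y j i + e * z i.
  move=> xB; have [|j _ [z zB zE]] := cover (diagonal_operator alpha x).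
    by exists x.
  by exists j, z; split=> // i; exact: esym (congr1 (fun u => u i) zE).
have [] := cover_separation p0 hM1 hM2 alpha0 alpha_dec e0 cover' m_gt0 b_gt0
  mbn large.
set z := _ / (64 * e) => z1 Mz.
have Jm : q * Orlicz_inverse M1 s <= Orlicz_inverse M1 m%:R^-1.
  apply: le_trans (Orlicz_inverse_le p0 hM1 _ sm m1); last first.
    by rewrite mulr_ge0// ltW.
  by apply: (Orlicz_inverse_scale p0 hM1) => //; [lra | exact: ltW].
have z0 : 0 <= z.
  rewrite /z divr_ge0 ?mulr_ge0 ?(ltW e0)//.
  by rewrite (le_trans _ Jm)// mulr_ge0 ?ltW.
have qz : q * z <= Orlicz_inverse M2 s.
  have q1 : q <= 1 by rewrite powR_le1 ?invr_ge0 ?(ltW p0)//; lra.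
  have qz0 : 0 <= q * z by rewrite mulr_ge0// ltW.
  have qz1 : q * z <= 1 by rewrite mulr_ile1// ltW.
  rewrite -(Orlicz_le_inverse p0 hM2 (ltW s0) s1 qz0 qz1).
  apply: le_trans (Orlicz_scale p0 hM2 _ _ z0 z1) _ => //; first lra.
  by apply: le_trans ms; move: Mz; move: (M2 z) m%:R^-1 => a d; lra.
rewrite mulrA mulrAC ler_pdivrMr// mulrAC ler_pdivlMr//.
have : q * (alpha n.-1 * (q * Orlicz_inverse M1 s) / (64 * e)) <=
  Orlicz_inverse M2 s.
  apply: le_trans qz; rewrite ler_pM2l// /z ler_pM2r ?invr_gt0 ?mulr_gt0//.
  by rewrite ler_wpM2l.
rewrite mulrA ler_pdivrMr ?mulr_gt0//.
lra.
Qed.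

(** * Constants *)

Lemma powR_ge1 (R : realType) (a x : R) : 1 <= a -> 0 <= x -> 1 <= a `^ x.
Proof. by move=> a1 x0; rewrite -(powRr0 a) ler_powR. Qed.

Lemma powR2_pV_ge2 (R : realType) (p : R) : 0 < p -> p <= 1 -> 2 <= 2 `^ p^-1.
Proof. by move=> p0 p1; rewrite le1r_powR ?ler1n// invf_ge1. Qed.

Lemma powR2_19 (R : realType) (p : R) : 2 `^ (19 / p) = (2 `^ p^-1) ^+ 19.
Proof. by rewrite mulrC powRrM powR_mulrn// powR_ge0. Qed.

Lemma log2_24_ge1 (R : realType) (p : R) : 0 < p -> p <= 1
  -> 1 <= log2 (24 / p).
Proof. by move=> p0 p1; rewrite log2_ge1// ler_pdivlMr//; lra. Qed.

(** With h = 2^(1/p) >= 2, the logarithm and 1/p only decrease c1, and h^(-19) / 16 <= h^(-4) / 64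
    since h^15 >= 4. *)
Lemma c1_le (R : realType) (p : R) : 0 < p -> p <= 1 ->
  c1 p <= (4^-1 `^ p^-1) ^+ 2 / 64.
Proof.
move=> p0 p1; rewrite /c1 !powRN powR2_19 !div1r.
have h2 := powR2_pV_ge2 p0 p1; set h := 2 `^ p^-1 in h2 *.
have h0 : 0 < h by lra.
have pV1 : 1 <= p^-1 by rewrite invf_ge1.
have -> : 4^-1 `^ p^-1 = h ^- 2.
  rewrite (_ : 4^-1 = 2 `^ (- 2)); last first.
    by rewrite powRN powR_mulrn//; congr (_^-1); ring.
  by rewrite -powRrM mulrC powRrM powRN powR_mulrn// powR_ge0.
set L := log2 _ `^ _; set Q := p^-1 `^ _.
have L1 : 1 <= L by rewrite powR_ge1 ?log2_24_ge1// divr_ge0// ltW.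
have Q1 : 1 <= Q by rewrite powR_ge1// (le_trans ler01).
apply: (@le_trans _ _ (4 ^- 2 * h ^- 19)).
  rewrite -mulrA ler_piMr ?mulr_ge0 ?invr_ge0 ?exprn_ge0 ?(ltW h0)//.
  rewrite mulr_ile1 ?invr_ge0 ?invf_le1 ?(le_trans ler01)//.
    exact: lt_le_trans L1.
  exact: lt_le_trans Q1.
have h15 : 4 <= h ^+ 15.
  have -> : 4 = 2 ^+ 2 :> R by ring.
  apply: (@le_trans _ _ (h ^+ 2)); first by rewrite lerXn2r ?nnegrE// ltW.
  by rewrite ler_eXn2l//; lra.
have -> : (h ^- 2) ^+ 2 / 64 = 4 ^- 2 * (h ^+ 4 * 4)^-1.
  by field; rewrite gt_eqF.
rewrite ler_pM2l ?invr_gt0 ?exprn_gt0//.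
rewrite lef_pV2 ?posrE ?mulr_gt0 ?exprn_gt0//.
by rewrite (_ : 19 = 4 + 15)%N// exprD ler_pM2l// exprn_gt0.
Qed.

(** With h = 2^(1/p), the left-hand side is 2 h^6 (1/p)^(1/p), and c2 has 4 h^19 in place of 2 h^6,
    times a logarithmic factor at least 1. *)
Lemma c2_ge (R : realType) (p : R) : 0 < p -> p <= 1 ->
  2 * (64 / p) `^ p^-1 <= c2 p.
Proof.
move=> p0 p1; rewrite /c2 powR2_19 !div1r.
have h2 := powR2_pV_ge2 p0 p1; set h := 2 `^ p^-1 in h2 *.
have h0 : 0 < h by lra.
have -> : (64 / p) `^ p^-1 = h ^+ 6 * p^-1 `^ p^-1.
  rewrite powRM ?invr_ge0 ?(ltW p0)//; congr (_ * _).
  rewrite (_ : 64 = 2 `^ 6); first by rewrite -powRrM mulrC powRrM powR_mulrn//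
    powR_ge0.
  by rewrite powR_mulrn//; ring.
set L := log2 _ `^ _.
have L1 : 1 <= L by rewrite powR_ge1 ?log2_24_ge1// divr_ge0// ltW.
rewrite mulrA ler_wpM2r ?powR_ge0//.
apply: (@le_trans _ _ (4 * h ^+ 19)); last first.
  by rewrite ler_peMr// mulr_ge0// exprn_ge0// ltW.
rewrite ler_pM ?exprn_ge0 ?(ltW h0)//; first by rewrite ler_nat.
by rewrite ler_eXn2l//; lra.
Qed.

Theorem theorem4p1 (R : realType) (p : R) (M1 M2 : R -> R)
    (k : nat) (alpha : nat -> R)
    (p_gt0 : 0 < p) (p_le1 : p <= 1)
    (M1_Orlicz : p_Orlicz_function p M1)
    (M2_Orlicz : p_Orlicz_function p M2)
    (ratio_nondecreasing :
      {in `[1, +oo[ &, {homo (fun t : R =>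
        fundamental_function M1 t / fundamental_function M2 t)
        : s t / s <= t}})
    (k_gt0 : (0 < k)%N)
    (alpha_ge0 : forall i : nat, 0 <= alpha i)
    (alpha_nonincreasing : nonincreasing_seq alpha)
    (alpha_1k : alpha 0%N = alpha k.-1) :
  ((c1 p * Theta M1 M2 alpha k)%:E <= diagonal_entropy M1 M2 alpha k)%E /\
  (diagonal_entropy M1 M2 alpha k <= (c2 p * Theta M1 M2 alpha k)%:E)%E.
Proof.
have Theta_ge0 : 0 <= Theta M1 M2 alpha k by rewrite /Theta bigmax_ge_id.
split.
  apply: le_trans (diagonal_entropy_ge p_gt0 M1_Orlicz M2_Orlicz k_gt0 alpha_ge0
    alpha_nonincreasing).
  by rewrite lee_fin ler_wpM2r// c1_le.
have entropy_le A := diagonal_entropy_le (A := A) p_gt0 p_le1 M1_Orlicz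
  M2_Orlicz
  ratio_nondecreasing k_gt0 alpha_ge0 alpha_nonincreasing alpha_1k.
(* When Theta vanishes, arbitrarily small A are used instead. *)
have [T_eq0|T_neq0] := eqVneq (Theta M1 M2 alpha k) 0; last first.
  apply: le_trans (entropy_le _ _ (lexx _)) _; first by rewrite lt0r T_neq0.
  by rewrite lee_fin mulrCA [leRHS]mulrC ler_wpM2l// c2_ge.
rewrite T_eq0 mulr0; apply/lee_addgt0Pr => eps eps_gt0; rewrite add0e.
set c := (64 / p) `^ p^-1 in entropy_le.
have c_gt0 : 0 < c by rewrite powR_gt0// divr_gt0.
(* This A makes the bound 2 A c equal to [eps]. *)
have eps_c : 0 < eps / (2 * c) by rewrite divr_gt0// mulr_gt0.
apply: le_trans (entropy_le _ eps_c _) _; first by rewrite T_eq0 ltW.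
by rewrite lee_fin mulrCA divfK// gt_eqF// mulr_gt0.
Qed.
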